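(* Let $K\ge 1$, $\theta^*\in\mathbb{R}^K$ and $\eta\in\mathbb{R}^K$. For each labeled sample size $n$ let $N=N(n)$ be the unlabeled sample size, with $n,N\to\infty$ and $n/N\to\rho\in(0,\infty)$. Let $\hat\theta_{\mathcal L},\hat\eta_{\mathcal L},\hat\eta_{\mathcal U}$ be random vectors in $\mathbb{R}^K$ satisfying $$ n^{1/2}\begin{pmatrix}\hat\theta_{\mathcal L}-\theta^*\\ \hat\eta_{\mathcal L}-\eta\\ \hat\eta_{\mathcal U}-\eta\end{pmatrix}\xrightarrow{d}\mathcal N\left(\begin{pmatrix}0_K\\0_K\\0_K\end{pmatrix},\begin{pmatrix}V_{\theta} & V_{\theta\eta} & 0\\ V_{\theta\eta} & V_{\eta,\mathcal L} & 0\\ 0 & 0 & \rho V_{\eta,\mathcal U}\end{pmatrix}\right), $$ where $V_\theta,V_{\theta\eta},V_{\eta,\mathcal L},V_{\eta,\mathcal U}$ are $K\times K$ matrices and $V_{\eta,\mathcal L}+\rho V_{\eta,\mathcal U}$ is invertible. Let $\hat V_{\theta\eta}\xrightarrow{p}V_{\theta\eta}$, $\hat V_{\eta,\mathcal L}\xrightarrow{p}V_{\eta,\mathcal L}$, $\hat V_{\eta,\mathcal U}\xrightarrow{p}V_{\eta,\mathcal U}$ be consistent estimators, set $\hat\omega_0=(\hat V_{\eta,\mathcal L}+\tfrac{n}{N}\hat V_{\eta,\mathcal U})^{-1}\hat V_{\theta\eta}$ and $$ \hat\theta_{\mathrm{PSPS}}=\hat\omega_0^{\top}\hat\eta_{\mathcal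 U}-\big(\hat\omega_0^{\top}\hat\eta_{\mathcal L}-\hat\theta_{\mathcal L}\big). $$ Then: (i) $\hat\theta_{\mathrm{PSPS}}\xrightarrow{p}\theta^*$ and $n^{1/2}(\hat\theta_{\mathrm{PSPS}}-\theta^* )\xrightarrow{d}\mathcal N(0,V_{\mathrm{PSPS}})$, where $$V_{\mathrm{PSPS}}=V_\theta-V_{\theta\eta}^{\top}\big(V_{\eta,\mathcal L}+\rho V_{\eta,\mathcal U}\big)^{-1}V_{\theta\eta}.$$ (ii) If, for a coordinate $k\in\{1,\dots,K\}$, the $k$-th column of $V_{\theta\eta}$ is not the zero vector and at least one of $V_{\eta,\mathcal L}$, $V_{\eta,\mathcal U}$ is positive definite, then $(V_{\mathrm{PSPS}})_{kk}\le (V_\theta)_{kk}$. (iii) If $\hat V_{\mathrm{PSPS}}$ is an estimator with $\hat V_{\mathrm{PSPS}}\xrightarrow{p}V_{\mathrm{PSPS}}$, $\alpha\in(0,1)$, and $\mathcal C_{\alpha,k}=\big(\hat\theta_{\mathrm{PSPS},k}\pm z_{1-\alpha/2}\sqrt{(\hat V_{\mathrm{PSPS}})_{kk}/n}\big)$, then $\lim_{n\to\infty}\mathbb P(\theta^*_k\in\mathcal C_{\alpha,k})=1-\alpha$ (for $k$ with $(V_{\mathrm{PSPS}})_{kk}>0$).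
   Context: Setting: a parameter $\theta^*\in\mathbb{R}^K$ of the joint law of (features, outcome) is estimated from $n$ labeled and $N$ unlabeled i.i.d. samples and a pre-trained ML predictor $\hat f$. $\hat\theta_{\mathcal L}$ is the output of a given estimation algorithm applied to labeled data with observed outcomes; $\hat\eta_{\mathcal L}$ and $\hat\eta_{\mathcal U}$ are outputs of the same algorithm applied to labeled and to unlabeled data with outcomes replaced by ML predictions; $\eta$ is the common probability limit of the latter two (not required to equal $\theta^*$). Since the joint limiting covariance matrix is symmetric, the two off-diagonal blocks written $V_{\theta\eta}$ coincide as displayed. $z_{1-\alpha/2}$ is the $(1-\alpha/2)$-quantile of the standard normal distribution; $\hat\theta_{\mathrm{PSPS},k}$ and $\theta^*_k$ denote $k$-th coordinates. *)

(* Defs.v *)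
From HB Require Import structures.
From mathcomp Require Import all_boot all_order all_algebra.
From mathcomp Require Import all_classical all_reals all_analysis.
From mathcomp Require Import normal_distribution.
Set Implicit Arguments. Unset Strict Implicit. Unset Printing Implicit Defensive.
Import Order.TTheory GRing.Theory Num.Theory.
Import numFieldNormedType.Exports.
Local Open Scope classical_set_scope.
Local Open Scope ring_scope.

Section PSPSDefs.
Context {R : realType}.

(** Univariate normal law N(0, v), allowing the degenerate case v = 0
    (point mass at 0).  [normal_prob m s] is parameterized by the
    standard deviation s. *)
Definition normal0_law (v : R) : set R -> \bar R :=
  if v == 0 then \d_(0 : R) else normal_prob 0 (Num.sqrt v).

Definition std_normal_cdf (x : R) : \bar R := normal_prob (0 : R) 1 [set y | y <= x].

Context {d : measure_display} {Omega : measurableType d}.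

Definition random_mx (P : probability Omega R) m p (X : Omega -> 'M[R]_(m, p)) :=
  forall i j, measurable_fun setT (fun w => X w i j).

Definition has_normal0_law (P : probability Omega R) (Y : Omega -> R) (v : R) :=
  [/\ measurable_fun setT Y, 0 <= v &
      forall A : set R, measurable A -> P (Y @^-1` A) = normal0_law v A].

Definition gaussian_vector (P : probability Omega R) m (Z : Omega -> 'cV[R]_m)
    (Sigma : 'M[R]_m) :=
  Sigma^T = Sigma /\
  forall t : 'cV[R]_m,
    has_normal0_law P (fun w => (t^T *m Z w) 0 0) ((t^T *m Sigma *m t) 0 0).

(** Convergence in probability of a sequence of random matrices to a
    constant matrix c (norm = max-entry norm of MathComp-Analysis). *)
Definition conv_prob (P : probability Omega R) m p
    (X : nat -> Omega -> 'M[R]_(m, p)) (c : 'M[R]_(m, p)) :=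
  forall e : R, 0 < e ->
    (fun n => P [set w | e < `|X n w - c|]) @ \oo --> 0%E.

End PSPSDefs.

Section PSPSDefs2.
Context {R : realType} {d : measure_display} {Omega : measurableType d}.

Definition conv_dist_gauss (P : probability Omega R) m
    (X : nat -> Omega -> 'cV[R]_m) (Sigma : 'M[R]_m) :=
  exists (d' : measure_display) (T : measurableType d') (Q : probability T R)
         (Z : T -> 'cV[R]_m),
    random_mx Q Z /\ gaussian_vector Q Z Sigma /\
    forall f : 'cV[R]_m -> R, continuous f -> (exists M : R, forall x, `|f x| <= M) ->
      (fun n => (\int[P]_w (f (X n w))%:E)%E) @ \oo --> (\int[Q]_w (f (Z w))%:E)%E.

End PSPSDefs2.

Definition posdef {R : realType} m (M : 'M[R]_m) :=
  M^T = M /\ forall x : 'cV[R]_m, x != 0 -> 0 < (x^T *m M *m x) 0 0.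

Definition omega_hat {R : realType} K (n Nn : nat) (hVte hVL hVU : 'M[R]_K) :=
  invmx (hVL + (n%:R / Nn%:R) *: hVU) *m hVte.

Definition theta_PSPS {R : realType} K (om : 'M[R]_K) (thL etaL etaU : 'cV[R]_K) :=
  om^T *m etaU - (om^T *m etaL - thL).

Definition V_PSPS {R : realType} K (rho : R) (Vt Vte VL VU : 'M[R]_K) :=
  Vt - Vte^T *m invmx (VL + rho *: VU) *m Vte.

(* Main.v *)
Require Import Defs.
From HB Require Import structures.
From mathcomp Require Import all_boot all_order all_algebra.
From mathcomp Require Import all_classical all_reals all_analysis.
From mathcomp Require Import normal_distribution measurable_realfun.
From mathcomp Require Import ring lra.
Import Order.TTheory GRing.Theory Num.Theory.
Import numFieldNormedType.Exports.
Local Open Scope classical_set_scope.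
Local Open Scope ring_scope.
Set Implicit Arguments. Unset Strict Implicit. Unset Printing Implicit Defensive.

(** Write [X n] for the rescaled error vector of the three estimators. The rescaled
    error of the PSPS estimator is [A n *m X n], where [A n = (1, - om^T, om^T)] depends
    only on the estimated weight [om]. Inversion is continuous at the invertible limit
    [VL + rho *: VU], so [om] converges in probability; since [X] is tight, [A n *m X n]
    differs from [A0 *m X n] by an error that vanishes in probability, and Slutsky's
    lemma gives the limit law [N(0, A0 *m Sigma *m A0^T)], whose covariance is [V_PSPS]
    because the cross terms cancel at the optimal weight. The diagonal of
    [Vt - V_PSPS] is a quadratic form in [VL + rho *: VU], which is positive
    semidefinite as the covariance of a combination of the limit. For the
    coverage, [|Y| < z sqrt(hV)] is compared with [|Y| < z sqrt(V)] by a portmanteau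
    argument; symmetry and scaling of the normal law are read off the linear forms of
    the Gaussian limit vector, so no change of variables is needed. *)

(** * Measurability of matrix-valued maps, their norms, products and inverses *)

Section RandomMatrices.
Context {R : realType} {d : measure_display} {Omega : measurableType d}.
Variable P : probability Omega R.

(** Writing [x^-1] as [x] times the power [-1] of [x ^+ 2] reduces the claim to the measurability of
    real powers; at [x = 0] both sides are [0]. *)
Lemma measurable_funV (f : Omega -> R) :
  measurable_fun setT f -> measurable_fun setT (fun w => (f w)^-1).
Proof.
move=> mf.
have -> : (fun w => (f w)^-1) = (fun w => f w * ((f w ^+ 2) `^ (-1))).
  apply/funext => w; rewrite powR_inv1 ?sqr_ge0// expr2.
  have [->|f0] := eqVneq (f w) 0; first by rewrite invr0 mul0r.
  by rewrite invfM mulrA divff// mul1r.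
apply: measurable_funM => //.
apply: (@measurableT_comp _ _ _ _ _ _ (@powR R ^~ (-1))); first exact: measurable_powR.
exact: measurable_funX.
Qed.

Lemma measurable_set_lt (f g : Omega -> R) :
  measurable_fun setT f -> measurable_fun setT g -> measurable [set w | f w < g w].
Proof.
move=> mf mg; rewrite -[X in measurable X]setTI.
exact: (measurable_fun_ltr mf mg measurableT (_ : measurable [set true])).
Qed.

Lemma measurable_set_le (f g : Omega -> R) :
  measurable_fun setT f -> measurable_fun setT g -> measurable [set w | f w <= g w].
Proof.
move=> mf mg; rewrite -[X in measurable X]setTI.
exact: (measurable_fun_ler mf mg measurableT (_ : measurable [set true])).
Qed.

Lemma measurable_set_eq (f : Omega -> R) (x : R) :
  measurable_fun setT f -> measurable [set w | f w = x].
Proof.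
move=> mf; rewrite -[X in measurable X]setTI.
exact: (mf measurableT _ (measurable_set1 x)).
Qed.

(** The conjunct [0 < e] matters for matrices without entries, where the entrywise condition is
    vacuous. *)
Lemma mx_norm_lt m p (A : 'M[R]_(m, p)) (e : R) :
  (`|A| < e) <-> 0 < e /\ forall i j, `|A i j| < e.
Proof.
have := @mx_norm_ball R m p; rewrite predeq3E => /(_ 0 e A).
rewrite /ball_/= add0r normrN => <-; split.
  by move=> [e0 h]; split => // i j; have := h i j; rewrite /ball/= mxE add0r normrN.
by move=> [e0 h]; split => // i j; rewrite /ball/= mxE add0r normrN.
Qed.

Lemma mx_norm_le m p (A : 'M[R]_(m, p)) (e : R) : 0 <= e ->
  (forall i j, `|A i j| <= e) -> `|A| <= e.
Proof.
move=> e0 h; apply/ler_addgt0Pr => x x0; apply/ltW/mx_norm_lt; split.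
  exact: ltr_wpDl.
by move=> i j; rewrite (le_lt_trans (h i j))// ltrDl.
Qed.

Lemma le_mx_norm m p (A : 'M[R]_(m, p)) i j : `|A i j| <= `|A|.
Proof.
apply/ler_addgt0Pr => x x0; apply: ltW.
by have /mx_norm_lt[_] : `|A| < `|A| + x by rewrite ltrDl.
Qed.

Lemma mx_norm_trmx m p (A : 'M[R]_(m, p)) : `|A^T| = `|A|.
Proof.
have nT q r (B : 'M[R]_(q, r)) : `|B^T| <= `|B|.
  by apply: mx_norm_le => // i j; rewrite mxE le_mx_norm.
by apply/eqP; rewrite eq_le nT -{1}[A]trmxK nT.
Qed.

(* Every open set of matrices is a countable union of balls with rational data. *)
Lemma random_mx_open m p (X : Omega -> 'M[R]_(m, p)) (U : set 'M[R]_(m, p)) :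
  random_mx P X -> open U -> measurable (X @^-1` U).
Proof.
move=> mX oU.
pose B (q : 'M[rat]_(m, p) * rat) : set 'M[R]_(m, p) :=
  [set A | `|A - map_mx ratr q.1| < ratr q.2].
pose S := [set q | B q `<=` U].
(* The union runs over the whole countable type of rational centres and radii; pairs outside [S]
   contribute the empty set. *)
have -> : X @^-1` U = \bigcup_(q : 'M[rat]_(m, p) * rat)
    (if q \in S then X @^-1` (B q) else set0).
  apply/seteqP; split => w /=; last first.
    by move=> [q _]; case: ifPn => // /set_mem; apply.
  move=> Uw; have /nbhs_ballP[e /= e0 eU] : nbhs (X w) U by exact: open_nbhs_nbhs.
  (* A rational radius [r < e / 2] and a rational centre within [r] of [X w] give a ball that
     contains [X w] and, by the triangle inequality, stays within [e] of it, hence inside [U]. *)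
  have e20 : 0 < e / 2 by rewrite divr_gt0.
  have [r] := rat_in_itvoo e20; rewrite in_itv/= => /andP[r0 re].
  have near i j : exists q : rat, `|X w i j - ratr q| < ratr r.
    have lt : X w i j - ratr r < X w i j by rewrite ltrBlDr ltrDl.
    have [q] := rat_in_itvoo lt; rewrite in_itv/= => /andP[q1 q2].
    by exists q; rewrite gtr0_norm ?subr_gt0// ltrBlDr addrC -ltrBlDr.
  pose Q := \matrix_(i < m, j < p) projT1 (cid (near i j)).
  have QB : B (Q, r) (X w).
    rewrite /B/=; apply/mx_norm_lt; split => // i j.
    by rewrite !mxE; case: (cid _).
  exists (Q, r) => //; rewrite ifT//; apply/mem_set => A.
  rewrite /B/= => AB; apply: eU; rewrite -ball_normE/=.
  rewrite (_ : X w - A = (X w - map_mx ratr Q) - (A - map_mx ratr Q)).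
    rewrite (le_lt_trans (ler_normB _ _))// [ltRHS]splitr ltrD//.
      by rewrite (lt_trans QB).
    by rewrite (lt_trans AB).
  by rewrite opprB addrA subrK.
apply: countable_bigcupT_measurable; first exact: countableP.
move=> q; case: ifPn => // _.
have [r0|r0] := ltP 0 (ratr q.2 : R); last first.
  rewrite (_ : X @^-1` _ = set0)//; apply/seteqP; split => // w.
  by rewrite /B/= => /mx_norm_lt[]; rewrite ltNge r0.
(* A max-norm ball of positive radius is a finite intersection of conditions on single entries. *)
rewrite (_ : X @^-1` _ =
  \bigcap_(ij in [set: 'I_m * 'I_p])
     [set w | `|X w ij.1 ij.2 - ratr (q.1 ij.1 ij.2)| < ratr q.2]).
  apply: fin_bigcap_measurable => // ij _.
  apply: measurable_set_lt => //; apply: measurableT_comp => //.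
  exact: measurable_funB.
apply/seteqP; split => w.
  by rewrite /B/= => /mx_norm_lt[_ h] ij _ /=; have := h ij.1 ij.2; rewrite !mxE.
move=> h; rewrite /B/=; apply/mx_norm_lt; split => // i j.
by have := h (i, j) Logic.I; rewrite !mxE.
Qed.

Lemma random_mx_continuous m p (X : Omega -> 'M[R]_(m, p)) (f : 'M[R]_(m, p) -> R) :
  random_mx P X -> continuous f -> measurable_fun setT (fun w => f (X w)).
Proof.
move=> mX cf; apply: (measurability _ (RGenOpens.measurableE R)).
move=> _ [_ [a [b ->]] <-]; rewrite setTI.
rewrite -[X in measurable X]/(X @^-1` (f @^-1` _)).
apply: random_mx_open => //.
apply: open_comp; last exact: interval_open.
by move=> x _; exact: cf.
Qed.

Lemma random_mx_norm m p (X : Omega -> 'M[R]_(m, p)) :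
  random_mx P X -> measurable_fun setT (fun w => `|X w|).
Proof. by move=> mX; apply: random_mx_continuous => //; exact: norm_continuous. Qed.

Lemma random_mx_cst m p (A : 'M[R]_(m, p)) : random_mx P (fun=> A).
Proof. by move=> i j; exact: measurable_cst. Qed.

Lemma random_mxD m p (X Y : Omega -> 'M[R]_(m, p)) :
  random_mx P X -> random_mx P Y -> random_mx P (fun w => X w + Y w).
Proof.
move=> mX mY i j; under eq_fun do rewrite mxE.
exact: measurable_funD.
Qed.

Lemma random_mxZ m p (c : R) (X : Omega -> 'M[R]_(m, p)) :
  random_mx P X -> random_mx P (fun w => c *: X w).
Proof.
move=> mX i j; under eq_fun do rewrite mxE.
exact: measurable_funM.
Qed.

Lemma random_mxB m p (X Y : Omega -> 'M[R]_(m, p)) :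
  random_mx P X -> random_mx P Y -> random_mx P (fun w => X w - Y w).
Proof.
move=> mX mY i j; under eq_fun do rewrite !mxE.
exact: measurable_funB.
Qed.

Lemma random_mxT m p (X : Omega -> 'M[R]_(m, p)) :
  random_mx P X -> random_mx P (fun w => (X w)^T).
Proof. by move=> mX i j; under eq_fun do rewrite mxE; exact: mX. Qed.

Lemma random_mxM m p q (X : Omega -> 'M[R]_(m, p)) (Y : Omega -> 'M[R]_(p, q)) :
  random_mx P X -> random_mx P Y -> random_mx P (fun w => X w *m Y w).
Proof.
move=> mX mY i j; under eq_fun do rewrite mxE.
by apply: measurable_sum => k; exact: measurable_funM.
Qed.

Lemma random_col_mx m n p (X : Omega -> 'M[R]_(m, p)) (Y : Omega -> 'M[R]_(n, p)) :
  random_mx P X -> random_mx P Y -> random_mx P (fun w => col_mx (X w) (Y w)).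
Proof.
move=> mX mY i j; under eq_fun do rewrite mxE.
by case: (fintype.split i) => k; [exact: mX|exact: mY].
Qed.

Lemma measurable_det m (X : Omega -> 'M[R]_m) :
  random_mx P X -> measurable_fun setT (fun w => \det (X w)).
Proof.
move=> mX; rewrite /determinant; apply: measurable_sum => s.
apply: (@measurable_funM _ _ _ _ (cst _)); first exact: measurable_cst.
by apply: measurable_prod => i _; exact: mX.
Qed.

(** Cramer's rule makes each entry a quotient of polynomials in the entries of [X]. On singular
    matrices [invmx] returns its argument, hence the case split on the determinant. *)
Lemma random_invmx m (X : Omega -> 'M[R]_m) :
  random_mx P X -> random_mx P (fun w => invmx (X w)).
Proof.
move=> mX i j.
have -> : (fun w => invmx (X w) i j) = (fun w => if \det (X w) == 0 then X w i j
    else (\det (X w))^-1 * cofactor (X w) j i).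
  apply/funext => w; rewrite /invmx unitmxE unitfE.
  by case: ifPn; rewrite ?negbK; [move/negbTE->|move=> ->]; rewrite ?mxE.
apply: measurable_fun_ifT => //.
- apply: measurable_fun_eqr; [exact: measurable_det|exact: measurable_cst].
- apply: measurable_funM; first by apply/measurable_funV/measurable_det.
  apply: (@measurable_funM _ _ _ _ (cst _)); first exact: measurable_cst.
  apply: measurable_det => k l.
  by under eq_fun do rewrite !mxE; exact: mX.
Qed.

End RandomMatrices.

(** * Bounds between probabilities and expectations of bounded functions *)

Section BoundedExpectation.
Context {R : realType} {d : measure_display} {Omega : measurableType d}.
Variable P : probability Omega R.

Lemma probability_sub (A B : set Omega) :
  measurable A -> measurable B -> A `<=` B -> (P A <= P B)%E.
Proof. by move=> mA mB; apply: le_measure; rewrite inE. Qed.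

Lemma probability_subU (A B C : set Omega) : measurable A -> measurable B ->
  measurable C -> A `<=` B `|` C -> (P A <= P B + P C)%E.
Proof.
move=> mA mB mC ABC; apply: le_trans (measureU2 P mB mC).
by apply: probability_sub => //; exact: measurableU.
Qed.

Lemma integrable_bounded (f : Omega -> R) (M : R) : measurable_fun setT f ->
  (forall w, `|f w| <= M) -> P.-integrable setT (EFin \o f).
Proof.
move=> mf fM; apply: measurable_bounded_integrable => //.
  by rewrite (le_lt_trans (probability_le1 _ _))// ltry.
exists M; split; first by rewrite num_real.
by move=> x Mx w _; exact: le_trans (fM w) (ltW Mx).
Qed.

Lemma integrable_indicator (A : set Omega) : measurable A ->
  P.-integrable setT (EFin \o (\1_A : Omega -> R)).
Proof.
move=> mA; apply: (@integrable_bounded _ 1); first exact: measurable_indic.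
by move=> w; rewrite indicE; case: (_ \in _); rewrite ?normr1 ?normr0.
Qed.

Lemma Rintegral_indic (A : set Omega) : measurable A ->
  \int[P]_w (\1_A w : R) = fine (P A).
Proof. by move=> mA; rewrite /Rintegral integral_indic// setIT. Qed.

Lemma le_expectation_prob (f : Omega -> R) (A : set Omega) :
  measurable_fun setT f -> measurable A -> (forall w, 0 <= f w <= 1) ->
  (forall w, ~ A w -> f w = 0) -> \int[P]_w f w <= fine (P A).
Proof.
move=> mf mA f01 fA; rewrite -Rintegral_indic//; apply: le_Rintegral => //.
- apply: (@integrable_bounded _ 1) => // w.
  by have /andP[f0 f1] := f01 w; rewrite ger0_norm.
- exact: integrable_indicator.
- move=> w _; rewrite indicE; case: (boolP (w \in A)) => wA.
    by have /andP[] := f01 w.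
  by rewrite fA//; move: wA; rewrite notin_setE.
Qed.

Lemma le_prob_expectation (f : Omega -> R) (A : set Omega) :
  measurable_fun setT f -> measurable A -> (forall w, 0 <= f w <= 1) ->
  (forall w, A w -> f w = 1) -> fine (P A) <= \int[P]_w f w.
Proof.
move=> mf mA f01 fA; rewrite -Rintegral_indic//; apply: le_Rintegral => //.
- exact: integrable_indicator.
- apply: (@integrable_bounded _ 1) => // w.
  by have /andP[f0 f1] := f01 w; rewrite ger0_norm.
- move=> w _; rewrite indicE; case: (boolP (w \in A)) => wA.
    by rewrite fA//; exact: set_mem.
  by have /andP[] := f01 w.
Qed.

(** Pointwise, [|f - g|] is at most [e] plus [M + M] times the indicator of [A]; integrating gives
    the bound. *)
Lemma dist_expectation (f g : Omega -> R) (A : set Omega) (M e : R) :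
  measurable_fun setT f -> measurable_fun setT g -> measurable A ->
  (forall w, `|f w| <= M) -> (forall w, `|g w| <= M) -> 0 <= e ->
  (forall w, ~ A w -> `|f w - g w| <= e) ->
  `|\int[P]_w f w - \int[P]_w g w| <= e + (M + M) * fine (P A).
Proof.
move=> mf mg mA fM gM e0 fg.
have fi := integrable_bounded mf fM; have gi := integrable_bounded mg gM.
have fgM w : `|f w - g w| <= M + M by rewrite (le_trans (ler_normB _ _))// lerD.
have mfg : measurable_fun setT (f \- g) by exact: measurable_funB.
have fgi := integrable_bounded mfg fgM.
(* Nonnegativity is read off the bound at the distinguished point of [Omega]. *)
have M0 : 0 <= M + M by rewrite (le_trans _ (fgM point)).
rewrite -RintegralB// (le_trans (le_normr_Rintegral _ fgi))//.
have mi : measurable_fun setT (fun w => (M + M) * (\1_A w : R)).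
  by apply: (@measurable_funM _ _ _ _ (cst _)) => //; exact: measurable_indic.
have ii : P.-integrable setT (EFin \o (fun w => (M + M) * (\1_A w : R))).
  apply: (@integrable_bounded _ (M + M)) => // w.
  by rewrite normrM ger0_norm// indicE; case: (_ \in _);
    rewrite ?normr1 ?normr0 ?mulr1 ?mulr0.
have ci : P.-integrable setT (EFin \o (fun _ : Omega => e)).
  by apply: (@integrable_bounded _ e) => // w; rewrite ger0_norm.
have -> : e + (M + M) * fine (P A) = \int[P]_w (e + (M + M) * (\1_A w : R)).
  rewrite RintegralD// Rintegral_cst// [X in e * fine X](_ : _ = 1%E) ?mulr1; last first.
    exact: probability_setT.
  rewrite RintegralZl//; first by rewrite Rintegral_indic.
  exact: integrable_indicator.
apply: le_Rintegral => //.
- apply: (@integrable_bounded _ (M + M)); first exact: measurableT_comp.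
  by move=> w; rewrite normr_id fgM.
- apply: (@integrable_bounded _ (e + (M + M))).
    exact: measurable_funD.
  move=> w; rewrite (le_trans (ler_normD _ _))// lerD ?ger0_norm//.
    by rewrite indicE; case: (_ \in _); rewrite ?mulr1 ?mulr0.
  by rewrite mulr_ge0.
- move=> w _; rewrite indicE; case: (boolP (w \in A)) => wA.
    by rewrite mulr1 (le_trans (fgM w))// lerDr.
  by rewrite mulr0 addr0 fg//; move: wA; rewrite notin_setE.
Qed.

(** Continuity from above: the events [|h w| < 1/(k+1)] decrease to the null event [h w = 0]. *)
Lemma small_ball_prob (h : Omega -> R) (a : R) : measurable_fun setT h ->
  P [set w | h w = 0] = 0%E -> 0 < a ->
  exists2 e : R, 0 < e & fine (P [set w | `|h w| < e]) <= a.
Proof.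
move=> mh h0 a0.
pose F (k : nat) := [set w | `|h w| < k.+1%:R^-1].
have mF k : measurable (F k).
  by apply: measurable_set_lt => //; exact: measurableT_comp.
have capF : \bigcap_k F k = [set w | h w = 0].
  apply/seteqP; split => w /=; last first.
    by move=> hw0 k _; rewrite /F/= hw0 normr0 invr_gt0 ltr0n.
  move=> hF; apply/eqP; rewrite -normr_eq0; apply/negP => /negP hw0.
  have hw : 0 < `|h w| by rewrite lt_neqAle eq_sym hw0/=.
  (* With [k] the integer part of [1/|h w|], one has [1/|h w| < k+1], which contradicts membership
     in [F k]. *)
  have := hF (Num.truncn (`|h w|^-1)) Logic.I; rewrite /F/= ltNge => /negP; apply.
  rewrite -[leRHS]invrK lef_pV2 ?posrE ?invr_gt0//.
  exact/ltW/truncnS_gt.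
have : (P \o F) @ \oo --> P (\bigcap_k F k).
  apply: nonincreasing_cvg_mu => //.
  - by rewrite (le_lt_trans (probability_le1 P (mF 0%N)))// ltry.
  - exact: bigcapT_measurable.
  - move=> m n mn; apply/subsetPset => w; rewrite /F/= => /lt_le_trans; apply.
    by rewrite lef_pV2 ?posrE ?ltr0n// ler_nat ltnS.
rewrite capF h0 => /fine_cvgP[_ /cvgrPdist_le/(_ _ a0)].
move=> [k _ /(_ k)]/=; rewrite leqnn sub0r normrN => /(_ isT) ka.
by exists k.+1%:R^-1; [rewrite invr_gt0 ltr0n|rewrite (le_trans (ler_norm _))].
Qed.

End BoundedExpectation.

(** The max-entry norm is not submultiplicative: an entry of the product is a sum of [p] terms,
    hence the factor [p]. *)
Lemma mulmx_norm {R : realType} m p q (A : 'M[R]_(m, p)) (B : 'M[R]_(p, q)) :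
  `|A *m B| <= p%:R * (`|A| * `|B|).
Proof.
apply: mx_norm_le => [|i j]; first by rewrite !mulr_ge0.
rewrite mxE (le_trans (ler_norm_sum _ _ _))//.
rewrite (le_trans (_ : _ <= \sum_(k < p) `|A| * `|B|))//.
  by apply: ler_sum => k _; rewrite normrM ler_pM// le_mx_norm.
by rewrite sumr_const card_ord mulr_natl.
Qed.

(** * Events of probability tending to one, and boundedness in probability *)

Section HighProbability.
Context {R : realType} {d : measure_display} {Omega : measurableType d}.
Variable P : probability Omega R.

(* The complement of [A] need not be measurable: it only has to be covered by a
   measurable set of probability at most [a]. *)
Definition fails_le (a : R) (A : set Omega) :=
  exists B, [/\ measurable B, fine (P B) <= a & ~` B `<=` A].

Definition whp (A : nat -> set Omega) :=
  forall a : R, 0 < a -> \forall n \near \oo, fails_le a (A n).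

Definition tight m p (X : nat -> Omega -> 'M[R]_(m, p)) :=
  forall a : R, 0 < a -> exists2 M : R, 0 < M &
    \forall n \near \oo, fails_le a [set w | `|X n w| <= M].

Lemma fails_leS a (A B : set Omega) : A `<=` B -> fails_le a A -> fails_le a B.
Proof. by move=> AB [C [mC Ca CA]]; exists C; split => // w /CA/AB. Qed.

Lemma fine_probability_le (A B : set Omega) : measurable A -> measurable B ->
  A `<=` B -> fine (P A) <= fine (P B).
Proof.
move=> mA mB AB; apply: fine_le; [exact: fin_num_measure..|].
exact: probability_sub.
Qed.

Lemma fine_probability_leU (A B C : set Omega) : measurable A -> measurable B ->
  measurable C -> A `<=` B `|` C -> fine (P A) <= fine (P B) + fine (P C).
Proof.
move=> mA mB mC ABC; rewrite -fineD; [|exact: fin_num_measure..].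
apply: fine_le; [exact: fin_num_measure| |exact: probability_subU].
by rewrite fin_numD !fin_num_measure.
Qed.

Lemma fails_leI a b (A B : set Omega) :
  fails_le a A -> fails_le b B -> fails_le (a + b) (A `&` B).
Proof.
move=> [C [mC Ca CA]] [D [mD Db DB]]; exists (C `|` D); split.
- exact: measurableU.
- have mCD := measurableU _ _ mC mD.
  by rewrite (le_trans (fine_probability_leU mCD mC mD _))// lerD.
- by move=> w; rewrite setCU => -[/CA ? /DB ?].
Qed.

Lemma fails_le_prob a (A : set Omega) : measurable A -> fails_le a A ->
  fine (P (~` A)) <= a.
Proof.
move=> mA [B [mB Ba BA]]; apply: le_trans Ba; apply: fine_probability_le => //.
  exact: measurableC.
by move=> w nA; apply: contrapT => /BA.
Qed.

Lemma whpS (A B : nat -> set Omega) :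
  (\forall n \near \oo, A n `<=` B n) -> whp A -> whp B.
Proof.
move=> AB wA a a0; near=> n.
apply: (@fails_leS _ (A n)); first by near: n.
by near: n; exact: wA.
Unshelve. all: by end_near. Qed.

Lemma whpI (A B : nat -> set Omega) : whp A -> whp B -> whp (fun n => A n `&` B n).
Proof.
move=> wA wB a a0; have a20 : 0 < a / 2 by rewrite divr_gt0.
near=> n; rewrite [a]splitr; apply: fails_leI; near: n; [exact: wA|exact: wB].
Unshelve. all: by end_near. Qed.

Lemma conv_prob_whp m p (X : nat -> Omega -> 'M[R]_(m, p)) c e :
  (forall n, random_mx P (X n)) -> conv_prob P X c -> 0 < e ->
  whp (fun n => [set w | `|X n w - c| <= e]).
Proof.
move=> mX Xc e0 a a0.
have /fine_cvgP[_ /cvgrPdist_le/(_ _ a0)] := Xc e e0.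
apply: filterS => n; rewrite /= sub0r normrN => Pa.
exists [set w | e < `|X n w - c|]; split.
- apply: measurable_set_lt => //; apply: (@random_mx_norm _ _ _ P).
  by apply: random_mxB => //; exact: random_mx_cst.
- by rewrite (le_trans (ler_norm _)).
- by move=> w /= /negP; rewrite -leNgt.
Qed.

Lemma whp_conv_prob m p (X : nat -> Omega -> 'M[R]_(m, p)) c :
  (forall n, random_mx P (X n)) ->
  (forall e : R, 0 < e -> whp (fun n => [set w | `|X n w - c| <= e])) ->
  conv_prob P X c.
Proof.
move=> mX wX e e0.
have mE n : measurable [set w | e < `|X n w - c|].
  apply: measurable_set_lt => //; apply: (@random_mx_norm _ _ _ P).
  by apply: random_mxB => //; exact: random_mx_cst.
apply/fine_cvgP; split; first by near=> n; exact: fin_num_measure.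
apply/cvgrPdist_le => a a0; have := wX e e0 a a0; apply: filterS => n.
rewrite /= sub0r normrN ger0_norm ?fine_ge0//.
have -> : [set w | e < `|X n w - c|] = ~` [set w | `|X n w - c| <= e].
  by apply/seteqP; split => w /=; [rewrite leNgt => ->|move/negP; rewrite -ltNge].
apply: fails_le_prob; apply: measurable_set_le => //; apply: (@random_mx_norm _ _ _ P).
by apply: random_mxB => //; exact: random_mx_cst.
Unshelve. all: by end_near. Qed.

(** A factor vanishing in probability times a factor bounded in probability vanishes in
    probability. *)
Lemma whp_mul_tight m p q (D : nat -> Omega -> 'M[R]_(m, p))
    (X : nat -> Omega -> 'M[R]_(p, q)) (e : R) :
  (forall e : R, 0 < e -> whp (fun n => [set w | `|D n w| <= e])) -> tight X ->
  0 < e -> whp (fun n => [set w | `|D n w *m X n w| <= e]).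
Proof.
move=> wD tX e0 a a0; have a20 : 0 < a / 2 by rewrite divr_gt0.
have [M M0 XM] := tX _ a20.
(* Taking [p.+1] instead of [p] keeps the divisor positive when [p = 0]. *)
pose e' := e / (p.+1%:R * M).
have e'0 : 0 < e' by rewrite divr_gt0 ?mulr_gt0.
near=> n; rewrite [a]splitr.
apply: (@fails_leS _ ([set w | `|D n w| <= e'] `&` [set w | `|X n w| <= M])).
  move=> w /= [De XeM]; rewrite (le_trans (mulmx_norm _ _))//.
  rewrite (le_trans (_ : _ <= p.+1%:R * (e' * M)))//.
    by rewrite ler_pM ?ler_nat ?mulr_ge0// ler_pM.
  by rewrite /e' mulrCA divfK// gt_eqF// mulr_gt0.
by apply: fails_leI; near: n; [exact: wD|].
Unshelve. all: by end_near. Qed.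

End HighProbability.

(** * Entrywise limits, compact balls, uniform continuity and cutoff functions *)

Section MatrixLimits.
Context {R : realType}.

Lemma cvg_mx {T : Type} {F : set_system T} {FF : Filter F} m p
    (f : T -> 'M[R]_(m, p)) (A : 'M[R]_(m, p)) :
  (forall i j, f x i j @[x --> F] --> A i j) -> f x @[x --> F] --> A.
Proof.
move=> fA; apply/cvgrPdist_lt => e e0.
have : \forall x \near F, forall ij : 'I_m * 'I_p,
    `|A ij.1 ij.2 - f x ij.1 ij.2| < e.
  by apply: filter_forall => -[i j]; have /cvgrPdist_lt := fA i j; exact.
apply: filterS => x h; apply/mx_norm_lt; split => // i j.
by have := h (i, j); rewrite !mxE.
Qed.

Lemma cvg_mx_coord {T : Type} {F : set_system T} {FF : Filter F} m p
    (f : T -> 'M[R]_(m, p)) (A : 'M[R]_(m, p)) i j :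
  f x @[x --> F] --> A -> f x i j @[x --> F] --> A i j.
Proof.
move=> fA; exact: (cvg_comp f (fun M : 'M[R]_(m, p) => M i j) fA
  (@coord_continuous _ _ _ i j A)).
Qed.

Lemma trmx_continuous m p : continuous (@trmx R m p).
Proof.
move=> A; have := @cvg_mx _ (nbhs A) _ _ _ trmx A^T; apply => i j.
under eq_fun do rewrite mxE; rewrite mxE; exact: coord_continuous.
Qed.

(** Heine-Borel for row vectors is carried over by transposition, which is continuous and preserves
    the norm. *)
Lemma compact_cV_ball m (M : R) : compact [set x : 'cV[R]_m | `|x| <= M].
Proof.
have -> : [set x : 'cV[R]_m | `|x| <= M] =
    trmx @` [set x : 'rV[R]_m | `|x| <= M].
  apply/seteqP; split => x /=.
    by move=> xM; exists x^T; rewrite ?trmxK// mx_norm_trmx.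
  by move=> [y yM <-]; rewrite mx_norm_trmx.
apply: continuous_compact.
  exact/continuous_subspaceT/trmx_continuous.
apply: bounded_closed_compact.
  exists M; split; first by rewrite num_real.
  by move=> r Mr x /= xM; exact: le_trans xM (ltW Mr).
rewrite -[X in closed X]/((fun x : 'rV[R]_m => `|x|) @^-1` [set r : R | r <= M]).
apply: closed_comp; last exact: closed_le.
by move=> x _; exact: norm_continuous.
Qed.

(** Only [x] is confined to the ball; [y] may leave it. This suits a perturbation of a tight
    sequence, where the bound is known for one of the two vectors. *)
Lemma unif_continuous_cV_ball m (f : 'cV[R]_m -> R) (M e : R) :
  continuous f -> 0 < e -> exists2 r : R, 0 < r &
    forall x y, `|x| <= M -> `|x - y| <= r -> `|f x - f y| <= e.
Proof.
move=> cf e0; have e20 : 0 < e / 2 by rewrite divr_gt0.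
(* Compactness in its near-covering form: a property valid near each point of the ball for all small
   [r > 0] is valid on the whole ball for all small [r > 0]. *)
have /compact_near_coveringP/(_ R (0^'+)
  (fun r x => forall y, `|x - y| <= r -> `|f x - f y| <= e)) := @compact_cV_ball m M.
move=> /(_ _)[].
  move=> x _; have /cvgrPdist_lt/(_ _ e20)/nbhs_ballP[r /= r0 fr] := cf x.
  have r20 : 0 < r / 2 by rewrite divr_gt0.
  exists (ball x (r / 2), [set s : R | s < r / 2]); first split => /=.
  - exact: nbhsx_ballx.
  - exact: nbhs_right_lt.
  move=> [x' s]/= [xx' sr] y x'y.
  have h z : `|x - z| < r -> `|f x - f z| < e / 2.
    by move=> xz; apply: fr; rewrite -ball_normE.
  have xx'2 : `|x - x'| < r / 2 by move: xx'; rewrite -ball_normE.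
  rewrite (_ : f x' - f y = (f x - f y) - (f x - f x')); last first.
    by lra.
  rewrite (le_trans (ler_normB _ _))// [leRHS]splitr lerD// ltW// h//.
    rewrite (_ : x - y = (x - x') + (x' - y)); last by rewrite addrA subrK.
    rewrite (le_lt_trans (ler_normD _ _))// [ltRHS]splitr ltrD//.
    exact: le_lt_trans sr.
  by rewrite (lt_trans xx'2)// ltr_pdivrMr// ltr_pMr// ltr1n.
move=> r /= r0 hr.
exists (r / 2); first by rewrite divr_gt0.
move=> x y xM xy; apply: (hr (r / 2)) => //=.
- by rewrite sub0r normrN gtr0_norm ?divr_gt0// ltr_pdivrMr// ltr_pMr// ltr1n.
- by rewrite divr_gt0.
Qed.

(** For [0 < e], a continuous substitute for the indicator of [x <= 0]: it is [1] there, [0] from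
    [e] on, and affine in between. *)
Definition ramp (e x : R) : R := Num.max 0 (Num.min 1 (1 - x / e)).

Lemma ramp01 e x : 0 <= ramp e x <= 1.
Proof. by rewrite /ramp le_max lexx/= ge_max ler01 ge_min lexx. Qed.

Lemma ramp_eq1 e x : 0 < e -> x <= 0 -> ramp e x = 1.
Proof.
move=> e0 x0; rewrite /ramp (min_idPl _) ?(max_idPr _)//.
by rewrite lerBrDr gerDl pmulr_lle0// invr_gt0.
Qed.

Lemma ramp_eq0 e x : 0 < e -> e <= x -> ramp e x = 0.
Proof.
move=> e0 ex; rewrite /ramp; apply/max_idPl; rewrite ge_min; apply/orP; right.
by rewrite subr_le0 ler_pdivlMr// mul1r.
Qed.

Lemma ramp_continuous e : continuous (ramp e).
Proof.
have -> : ramp e = (fun=> 0) \max ((fun=> 1) \min (fun x => 1 - x / e)) by [].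
move=> x; apply: continuous_max; first exact: cvg_cst.
apply: continuous_min; first exact: cvg_cst.
by apply: cvgB; [exact: cvg_cst|exact: mulrr_continuous].
Qed.

End MatrixLimits.

(** * Weak convergence: tightness, Slutsky's lemma and a portmanteau statement *)

Section WeakConvergence.
Context {R : realType} {d : measure_display} {Omega : measurableType d}.
Context {d' : measure_display} {T : measurableType d'}.
Variables (P : probability Omega R) (Q : probability T R).

Definition weak_cvg m (X : nat -> Omega -> 'cV[R]_m) (Z : T -> 'cV[R]_m) :=
  forall f : 'cV[R]_m -> R, continuous f -> (exists M : R, forall x, `|f x| <= M) ->
  (fun n => \int[P]_w f (X n w)) @ \oo --> \int[Q]_w f (Z w).

(** Bounded continuous test functions have finite integrals, so convergence of extended-real
    integrals amounts to convergence of their real values. *)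
Lemma weak_cvgP m (X : nat -> Omega -> 'cV[R]_m) (Z : T -> 'cV[R]_m) :
  (forall n, random_mx P (X n)) -> random_mx Q Z ->
  (forall f : 'cV[R]_m -> R, continuous f -> (exists M : R, forall x, `|f x| <= M) ->
    (fun n => (\int[P]_w (f (X n w))%:E)%E) @ \oo --> (\int[Q]_w (f (Z w))%:E)%E)
  <-> weak_cvg X Z.
Proof.
move=> mX mZ.
have Xfin f n : continuous f -> (exists M : R, forall x, `|f x| <= M) ->
    (\int[P]_w (f (X n w))%:E)%E \is a fin_num.
  move=> cf [M fM]; apply: integrable_fin_num => //.
  apply: (@integrable_bounded _ _ _ P (f \o X n) M) => //.
    exact: (random_mx_continuous (mX n)).
  by move=> w; exact: fM.
have Zfin f : continuous f -> (exists M : R, forall x, `|f x| <= M) ->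
    (\int[Q]_w (f (Z w))%:E)%E \is a fin_num.
  move=> cf [M fM]; apply: integrable_fin_num => //.
  apply: (@integrable_bounded _ _ _ Q (f \o Z) M) => //.
    exact: (random_mx_continuous mZ).
  by move=> w; exact: fM.
split => XZ f cf fM.
  have := XZ f cf fM; rewrite -(fineK (Zfin f cf fM)).
  by move=> /fine_cvgP[_].
rewrite -(fineK (Zfin f cf fM)); apply/fine_cvgP; split.
  by near=> n; exact: Xfin.
exact: XZ.
Unshelve. all: by end_near. Qed.

Variables (m : nat) (X : nat -> Omega -> 'cV[R]_m) (Z : T -> 'cV[R]_m).
Hypotheses (mX : forall n, random_mx P (X n)) (mZ : random_mx Q Z).
Hypothesis XZ : weak_cvg X Z.

Lemma weak_cvg_le (f : 'cV[R]_m -> R) (a : R) :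
  continuous f -> (forall x, 0 <= f x <= 1) -> 0 < a ->
  \forall n \near \oo, `|\int[P]_w f (X n w) - \int[Q]_w f (Z w)| <= a.
Proof.
move=> cf f01 a0.
have fM : exists M : R, forall x, `|f x| <= M.
  by exists 1 => x; have /andP[f0 f1] := f01 x; rewrite ger0_norm.
have /cvgrPdist_le/(_ _ a0) := XZ cf fM.
by apply: filterS => n; rewrite distrC.
Qed.

(** The single vector [Z] is tight because [(1 + |Z|)^-1] never vanishes, so it is small only with
    small probability. A continuous test function equal to [0] on the ball of radius [M] and to [1]
    beyond radius [M + 1] transfers this to [X n] for large [n]. *)
Lemma weak_cvg_tight : tight P X.
Proof.
move=> a a0; have a20 : 0 < a / 2 by rewrite divr_gt0.
pose h w := (1 + `|Z w|)^-1.
have h0 w : 0 < 1 + `|Z w| by rewrite ltr_pwDl.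
have mh : measurable_fun setT h.
  apply: measurable_funV; apply: (@measurable_funD _ _ _ _ (cst _)) => //.
  exact: random_mx_norm mZ.
have Qh : Q [set w | h w = 0] = 0%E.
  rewrite (_ : [set w | _] = set0) ?measure0//; apply/seteqP; split => // w /=.
  by move/eqP; rewrite invr_eq0 gt_eqF.
have [e e0 he] := small_ball_prob mh Qh a20.
(* If [|Z w| > 1/e], then [h w < e], an event of probability at most [a / 2]. *)
pose M := e^-1.
have M0 : 0 < M by rewrite invr_gt0.
pose f (x : 'cV[R]_m) := 1 - ramp 1 (`|x| - M).
have cf : continuous f.
  have cN : continuous (fun x : 'cV[R]_m => `|x| - M).
    move=> x; apply: (@continuousB _ _ _ (fun x : 'cV[R]_m => `|x|) (cst M)).
      exact: norm_continuous.
    exact: cst_continuous.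
  have cr : continuous (fun x : 'cV[R]_m => ramp 1 (`|x| - M)).
    by move=> x; apply: (continuous_comp (cN x)); exact: ramp_continuous.
  move=> x; apply: (@continuousB _ _ _ (cst (1 : R))
    (fun x : 'cV[R]_m => ramp 1 (`|x| - M))).
    exact: cst_continuous.
  exact: cr.
have f01 x : 0 <= f x <= 1.
  have /andP[r0 r1] := ramp01 1 (`|x| - M).
  by rewrite /f subr_ge0 r1 lerBlDr lerDl.
exists (M + 1); first by rewrite addr_gt0.
have := weak_cvg_le cf f01 a20; apply: filterS => n /ler_distlDr fa.
have mN : measurable_fun setT (fun w => `|X n w|) by exact: random_mx_norm (mX n).
exists [set w | M + 1 < `|X n w|]; split.
- exact: measurable_set_lt.
- rewrite [a]splitr (le_trans _ (le_trans fa _))//.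
    apply: le_prob_expectation => //.
    + exact: random_mx_continuous (mX n) cf.
    + exact: measurable_set_lt.
    + move=> w /= Mw; rewrite /f ramp_eq0 ?subr0//.
      by rewrite lerBrDr addrC ltW.
  rewrite lerD2r (le_trans _ he)//; apply: le_expectation_prob => //.
  + exact: random_mx_continuous mZ cf.
  + by apply: measurable_set_lt => //; exact: measurableT_comp.
  + move=> w /= hw; rewrite /f ramp_eq1 ?subrr// subr_le0 leNgt.
    apply/negP => MZ; apply: hw; rewrite gtr0_norm ?invr_gt0//.
    by rewrite -[ltRHS]invrK ltf_pV2 ?posrE// (lt_trans MZ)// ltrDr ltr01.
- by move=> w /= /negP; rewrite -leNgt.
Qed.

(** With high probability [X n] lies in a fixed ball and [Y n] is close to it; uniform continuity of
    the test function there controls the difference, and its boundedness controls the exceptional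
    event. *)
Lemma slutsky (Y : nat -> Omega -> 'cV[R]_m) : (forall n, random_mx P (Y n)) ->
  (forall e : R, 0 < e -> whp P (fun n => [set w | `|X n w - Y n w| <= e])) ->
  weak_cvg Y Z.
Proof.
move=> mY XY f cf fM; have [M0 fM0] := fM.
pose M := `|M0| + 1.
have M_gt0 : 0 < M by rewrite ltr_wpDl.
have {}fM0 x : `|f x| <= M.
  by rewrite (le_trans (fM0 x))// (le_trans (ler_norm _))// lerDl.
apply/cvgrPdist_le => e e0.
have e30 : 0 < e / 3 by rewrite divr_gt0.
(* The error splits into thirds: convergence for [X], uniform continuity, and the exceptional event,
   whose contribution [(M + M) * a] equals [e / 3]. *)
pose a := e / 3 / (M + M).
have a0 : 0 < a by rewrite divr_gt0// addr_gt0.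
have a20 : 0 < a / 2 by rewrite divr_gt0.
have [L L0 XL] := weak_cvg_tight a20.
have [r r0 fr] := unif_continuous_cV_ball L cf e30.
near=> n.
have : fails_le P a ([set w | `|X n w| <= L] `&` [set w | `|X n w - Y n w| <= r]).
  by rewrite [a]splitr; apply: fails_leI; near: n; [|exact: XY].
move=> [B [mB PB Bn]].
have mfX : measurable_fun setT (fun w => f (X n w)).
  exact: random_mx_continuous (mX n) cf.
have mfY : measurable_fun setT (fun w => f (Y n w)).
  exact: random_mx_continuous (mY n) cf.
rewrite (_ : \int[Q]_w _ - _ = (\int[Q]_w f (Z w) - \int[P]_w f (X n w)) +
  (\int[P]_w f (X n w) - \int[P]_w f (Y n w))); last by rewrite addrA subrK.
rewrite (le_trans (ler_normD _ _))//.
rewrite (_ : e = e / 3 + (e / 3 + e / 3)); last first.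
  by lra.
rewrite lerD//.
  near: n; have /cvgrPdist_le := XZ cf fM; exact.
apply: (le_trans (@dist_expectation _ _ _ P _ _ B M (e / 3) mfX mfY mB
  _ _ (ltW e30) _)) => //.
- by move=> w /Bn[/= XwL XYw]; exact: fr.
- rewrite lerD2l (le_trans (ler_wpM2l _ PB))//; first by rewrite ltW// addr_gt0.
  by rewrite /a mulrC divfK// gt_eqF// addr_gt0.
Unshelve. all: by end_near. Qed.

(** The event [U n < 0] is sandwiched between [g (X n) < - e] and [g (X n) < e] up to a small event.
    Ramps shifted to either side of [0] pass these bounds to [Z], and the null boundary
    [g (Z w) = 0] makes the gap small. *)
Lemma portmanteau_lt0 (g : 'cV[R]_m -> R) (U : nat -> Omega -> R) :
  continuous g -> Q [set w | g (Z w) = 0] = 0%E ->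
  (forall n, measurable_fun setT (U n)) ->
  (forall e : R, 0 < e -> whp P (fun n => [set w | `|U n w - g (X n w)| <= e])) ->
  (fun n => P [set w | U n w < 0]) @ \oo --> Q [set w | g (Z w) < 0].
Proof.
move=> cg Qg0 mU Ug.
have mgZ : measurable_fun setT (fun w => g (Z w)).
  exact: random_mx_continuous mZ cg.
have mgX n : measurable_fun setT (fun w => g (X n w)).
  exact: random_mx_continuous (mX n) cg.
have mU0 n : measurable [set w | U n w < 0] by exact: measurable_set_lt.
have mZlt (b : R) : measurable [set w | g (Z w) < b] by exact: measurable_set_lt.
rewrite -[X in _ --> X]fineK; last exact: fin_num_measure.
apply/fine_cvgP; split; first by near=> n; exact: fin_num_measure.
apply/cvgrPdist_le => a a0; have a40 : 0 < a / 4 by rewrite divr_gt0.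
have [e' e'0 he] := small_ball_prob mgZ Qg0 a40.
(* The ramps live on [[e, 2 * e]] and [[- 2 * e, - e]], so the gap lies in [|g (Z w)| < e']. On each
   side the losses are three terms [a / 4]: exceptional event, ramp convergence, gap. *)
pose e := e' / 4.
have e0 : 0 < e by rewrite divr_gt0.
have ramp_cont (c : R) : continuous (fun x : 'cV[R]_m => ramp e (g x + c)).
  have cgc : continuous (fun x : 'cV[R]_m => g x + c).
    move=> x; apply: (@continuousD _ _ _ g (cst c)); first exact: cg.
    exact: cst_continuous.
  by move=> x; apply: (continuous_comp (cgc x)); exact: ramp_continuous.
have mrX n c : measurable_fun setT (fun w => ramp e (g (X n w) + c)).
  exact: random_mx_continuous (mX n) (ramp_cont c).
have mrZ c : measurable_fun setT (fun w => ramp e (g (Z w) + c)).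
  exact: random_mx_continuous mZ (ramp_cont c).
pose p := fine (Q [set w | g (Z w) < 0]).
near=> n.
have [B [mB PB Bn]] : fails_le P (a / 4) [set w | `|U n w - g (X n w)| <= e].
  by near: n; exact: Ug.
have up : `|\int[P]_w ramp e (g (X n w) + - e) - \int[Q]_w ramp e (g (Z w) + - e)|
    <= a / 4.
  near: n; apply: (weak_cvg_le (ramp_cont (- e))) => //.
  by move=> x; exact: ramp01.
have dn : `|\int[P]_w ramp e (g (X n w) + 2 * e) -
    \int[Q]_w ramp e (g (Z w) + 2 * e)| <= a / 4.
  near: n; apply: (weak_cvg_le (ramp_cont (2 * e))) => //.
  by move=> x; exact: ramp01.
have mgXlt (b : R) : measurable [set w | g (X n w) < b] by exact: measurable_set_lt.
have mball : measurable [set w | `|g (Z w)| < e'].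
  by apply: measurable_set_lt => //; exact: measurableT_comp.
have upper : fine (P [set w | U n w < 0]) <= p + a.
  have h1 : fine (P [set w | U n w < 0]) <= fine (P [set w | g (X n w) < e]) + fine (P B).
    apply: fine_probability_leU => // w /= Uw.
    have [Bw|/Bn/= hw] := pselect (B w); [by right|left].
    by move: hw; rewrite ler_norml => /andP[h _]; lra.
  have h2 : fine (P [set w | g (X n w) < e]) <= \int[P]_w ramp e (g (X n w) + - e).
    apply: le_prob_expectation => // [w|w /= gw]; first exact: ramp01.
    by rewrite ramp_eq1//; lra.
  have h3 : \int[Q]_w ramp e (g (Z w) + - e) <= fine (Q [set w | g (Z w) < 2 * e]).
    apply: le_expectation_prob => // [w|w /= /negP]; first exact: ramp01.
    by rewrite -leNgt => gw; rewrite ramp_eq0//; lra.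
  have h4 : fine (Q [set w | g (Z w) < 2 * e]) <= p + fine (Q [set w | `|g (Z w)| < e']).
    apply: fine_probability_leU => // w /= gw.
    have [g0|g0] := ltP (g (Z w)) 0; [by left|right].
    by rewrite ger0_norm// (lt_trans gw)// /e; lra.
  move: up; rewrite ler_norml => /andP[_ up]; lra.
have lower : p <= fine (P [set w | U n w < 0]) + a.
  have h1 : fine (P [set w | g (X n w) < - e]) <= fine (P [set w | U n w < 0]) + fine (P B).
    apply: fine_probability_leU => // w /= gw.
    have [Bw|/Bn/= hw] := pselect (B w); [by right|left].
    by move: hw; rewrite ler_norml => /andP[_ h]; lra.
  have h2 : \int[P]_w ramp e (g (X n w) + 2 * e) <= fine (P [set w | g (X n w) < - e]).
    apply: le_expectation_prob => // [w|w /= /negP]; first exact: ramp01.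
    by rewrite -leNgt => gw; rewrite ramp_eq0//; lra.
  have h3 : fine (Q [set w | g (Z w) < - 2 * e]) <= \int[Q]_w ramp e (g (Z w) + 2 * e).
    apply: le_prob_expectation => // [w|w /= gw]; first exact: ramp01.
    by rewrite ramp_eq1//; lra.
  have h4 : p <= fine (Q [set w | g (Z w) < - 2 * e]) + fine (Q [set w | `|g (Z w)| < e']).
    apply: fine_probability_leU => // w /= gw.
    have [g0|g0] := ltP (g (Z w)) (- 2 * e); [by left|right].
    by rewrite ltr0_norm// /e in g0 *; lra.
  move: dn; rewrite ler_norml => /andP[dn _]; lra.
by rewrite ler_norml; apply/andP; split; rewrite /= -/p; lra.
Unshelve. all: by end_near. Qed.

End WeakConvergence.

(** * Continuity of matrix products, determinants and inverses *)

Section MatrixContinuity.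
Context {R : realType} {T : Type} {F : set_system T} {FF : Filter F}.

Lemma cvg_mulmx m p q (f : T -> 'M[R]_(m, p)) (g : T -> 'M[R]_(p, q))
    (A : 'M[R]_(m, p)) (B : 'M[R]_(p, q)) :
  f x @[x --> F] --> A -> g x @[x --> F] --> B -> f x *m g x @[x --> F] --> A *m B.
Proof.
move=> fA gB; apply: cvg_mx => i j; under eq_fun do rewrite mxE; rewrite mxE.
apply: cvg_big => [|k _]; first exact: add_continuous.
by apply: cvgM; exact: cvg_mx_coord.
Qed.

Lemma cvg_det m (f : T -> 'M[R]_m) (A : 'M[R]_m) :
  f x @[x --> F] --> A -> \det (f x) @[x --> F] --> \det A.
Proof.
move=> fA; apply: cvg_big => [|s _]; first exact: add_continuous.
apply: cvgM; first exact: cvg_cst.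
apply: cvg_big => [|i _]; first exact: mul_continuous.
exact: cvg_mx_coord.
Qed.

Lemma cvg_invmx m (f : T -> 'M[R]_m) (A : 'M[R]_m) : A \in unitmx ->
  f x @[x --> F] --> A -> invmx (f x) @[x --> F] --> invmx A.
Proof.
move=> Au fA; have dA : \det A != 0 by rewrite -unitfE -unitmxE.
have df := cvg_det fA.
(* Near the limit [f x] is invertible, so [invmx (f x)] is given by the adjugate formula and not by
   its default value. *)
have fu : \forall x \near F, \det (f x) != 0.
  exact: cvgr_neq0 df dA.
have : (\det (f x))^-1 *: \adj (f x) @[x --> F] --> invmx A.
  rewrite /invmx Au; apply: cvg_mx => i j; under eq_fun do rewrite !mxE.
  rewrite !mxE; apply: cvgM; first exact: cvgV.
  apply: cvgM; first exact: cvg_cst.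
  apply: cvg_det; apply: cvg_mx => k l; under eq_fun do rewrite !mxE.
  by rewrite !mxE; exact: cvg_mx_coord.
apply: cvg_trans; apply: near_eq_cvg.
by apply: filterS fu => x dx; rewrite /invmx unitmxE unitfE dx.
Qed.

End MatrixContinuity.

(** Joint continuity of the weight, stated as an explicit modulus so that it can be applied outcome
    by outcome on a high-probability event. *)
Lemma omega_hat_limit {R : realType} K (A B C : 'M[R]_K) (r e : R) :
  B + r *: C \in unitmx -> 0 < e -> exists2 s : R, 0 < s &
  forall A' B' C' r', `|A' - A| <= s -> `|B' - B| <= s -> `|C' - C| <= s ->
    `|r' - r| <= s ->
    `|invmx (B' + r' *: C') *m A' - invmx (B + r *: C) *m A| <= e.
Proof.
move=> Su e0.
pose f (x : ('M[R]_K * 'M[R]_K) * ('M[R]_K * R)) :=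
  invmx (x.1.2 + x.2.2 *: x.2.1) *m x.1.1.
pose x0 := ((A, B), (C, r)).
have : f x @[x --> x0] --> invmx (B + r *: C) *m A.
  have c11 : x.1.1 @[x --> x0] --> A by apply: (cvg_comp _ _ cvg_fst); exact: cvg_fst.
  have c12 : x.1.2 @[x --> x0] --> B by apply: (cvg_comp _ _ cvg_fst); exact: cvg_snd.
  have c21 : x.2.1 @[x --> x0] --> C by apply: (cvg_comp _ _ cvg_snd); exact: cvg_fst.
  have c22 : x.2.2 @[x --> x0] --> r by apply: (cvg_comp _ _ cvg_snd); exact: cvg_snd.
  apply: cvg_mulmx => //; apply: cvg_invmx => //.
  by apply: cvgD => //; exact: cvgZ.
move=> /cvgrPdist_le/(_ _ e0)/nbhs_ballP[s /= s0 hs].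
(* Halving turns the closed bounds of the statement into membership in the open ball of radius
   [s]. *)
exists (s / 2); first by rewrite divr_gt0.
have h2 (x : R) : x <= s / 2 -> x < s.
  by move=> /le_lt_trans; apply; rewrite ltr_pdivrMr// ltr_pMr// ltr1n.
move=> A' B' C' r' AA BB CC rr; rewrite distrC.
apply: (hs ((A', B'), (C', r'))).
by split; split => /=; rewrite -ball_normE/= distrC; exact: h2.
Qed.

(** * Gaussian vectors and two-sided normal quantiles *)

Section Gaussian.
Context {R : realType} {d : measure_display} {T : measurableType d}.
Variable Q : probability T R.

(** The linear form [t] of [A *m Z] is the linear form [A^T *m t] of [Z]. *)
Lemma gaussian_vector_linear m p (Z : T -> 'cV[R]_m) S (A : 'M[R]_(p, m)) :
  gaussian_vector Q Z S -> gaussian_vector Q (fun w => A *m Z w) (A *m S *m A^T).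
Proof.
move=> [ST Zt]; split; first by rewrite !trmx_mul trmxK ST mulmxA.
move=> t; have := Zt (A^T *m t); rewrite trmx_mul trmxK !mulmxA.
by under [in X in X -> _]eq_fun do rewrite -mulmxA.
Qed.

Lemma normal_prob_set1 (m s x : R) : normal_prob m s [set x] = 0%E.
Proof. by rewrite /normal_prob integral_set1. Qed.

(** Symmetry enters through the law of [- W]: the same one-sided computation gives both tails
    probability [a / 2], and the tails are disjoint once [z > 0]. *)
Lemma normal_two_sided (W : T -> R) (z a : R) :
  has_normal0_law Q W 1 -> has_normal0_law Q (fun w => - W w) 1 ->
  0 < a < 1 -> std_normal_cdf z = (1 - a / 2)%:E ->
  Q [set w | `|W w| = z] = 0%E /\ Q [set w | `|W w| < z] = (1 - a)%:E.
Proof.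
move=> [mW _ QW] [mNW _ QNW] /andP[a0 a1] cdf.
have lawE A : normal0_law 1 A = normal_prob (0 : R) 1 A.
  by rewrite /normal0_law oner_eq0 sqrtr1.
have tail (V : T -> R) : measurable_fun setT V ->
    (forall A : set R, measurable A -> Q (V @^-1` A) = normal0_law 1 A) ->
    Q [set w | V w = z] = 0%E /\ fine (Q [set w | z <= V w]) = a / 2.
  move=> mV QV.
  have eq0 : Q [set w | V w = z] = 0%E.
    rewrite -[[set w | V w = z]]/(V @^-1` [set z]) QV// lawE.
    exact: normal_prob_set1.
  have mlt : measurable [set w | V w < z] by exact: measurable_set_lt.
  have meq : measurable [set w | V w = z] by exact: measurable_set_eq.
  have geE : [set w | z <= V w] = ~` [set w | V w < z].
    by apply/seteqP; split => w /=; [rewrite leNgt => /negP|move/negP; rewrite -leNgt].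
  have mle : measurable [set w | V w <= z] by exact: measurable_set_le.
  have leQ : fine (Q [set w | V w <= z]) = 1 - a / 2.
    rewrite -[[set w | V w <= z]]/(V @^-1` [set y | y <= z]) QV ?lawE.
      by rewrite -/(std_normal_cdf z) cdf.
    by rewrite -set_itvNyc; exact: measurable_itv.
  split => //.
  have ltQ : fine (Q [set w | V w < z]) = 1 - a / 2.
    rewrite -leQ; apply/eqP; rewrite eq_le; apply/andP; split.
      by apply: fine_probability_le => // w /= /ltW.
    rewrite (le_trans (@fine_probability_leU _ _ _ Q _ [set w | V w < z]
      [set w | V w = z] _ _ _ _))//.
      by move=> w /=; rewrite le_eqVlt => /predU1P[|]; [right|left].
    by rewrite eq0 addr0.
  rewrite geE probability_setC// fineB ?fin_num_measure//= ltQ; lra.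
have [W0 Wz] := tail _ mW QW.
have [N0 Nz] := tail _ mNW QNW.
have mge (V : T -> R) : measurable_fun setT V -> measurable [set w | z <= V w].
  by move=> mV; exact: measurable_set_le.
have meq (V : T -> R) : measurable_fun setT V -> measurable [set w | V w = z].
  by move=> mV; exact: measurable_set_eq.
have mab : measurable_fun setT (fun w => `|W w|) by exact: measurableT_comp.
have mlt : measurable [set w | `|W w| < z] by exact: measurable_set_lt.
have m0 : measurable [set w | `|W w| = z] by exact: measurable_set_eq.
split.
  apply/eqP; rewrite eq_le measure_ge0 andbT.
  rewrite (le_trans (@probability_subU _ _ _ Q _ _ _ m0 (meq _ mW) (meq _ mNW) _))//.
    by move=> w /=; case: (ger0P (W w)) => _ wz; [left|right].
  by rewrite W0 N0 adde0.
have mU := measurableU _ _ (mge _ mW) (mge _ mNW).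
(* The union bound on the two tails requires no disjointness, so it precedes the sign of [z]. *)
have lb : 1 - a <= fine (Q [set w | `|W w| < z]).
  have : fine (Q (~` [set w | `|W w| < z])) <= a / 2 + a / 2.
    rewrite -{1}Wz -Nz; apply: fine_probability_leU; [exact: measurableC|exact: mge..|].
    move=> w /= /negP; rewrite -leNgt.
    by case: (ger0P (W w)) => _ wz; [left|right].
  rewrite probability_setC// fineB ?fin_num_measure//=; lra.
(* For [z <= 0] the event would be empty, against the lower bound [1 - a > 0]. *)
have z0 : 0 < z.
  rewrite ltNge; apply/negP => z0; move: lb.
  rewrite (_ : [set w | _] = set0) ?measure0/=; first by lra.
  by apply/seteqP; split => // w /=; have := normr_ge0 (W w); lra.
apply/eqP; rewrite -[X in X == _]fineK ?fin_num_measure// eqe eq_le lb andbT.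
have : fine (Q [set w | `|W w| < z]) <=
    fine (Q (~` ([set w | z <= W w] `|` [set w | z <= - W w]))).
  apply: fine_probability_le => //; first exact: measurableC.
  move=> w /= wz [] h; move: wz; rewrite ltNge => /negP; apply.
    by rewrite (le_trans h)// ler_norm.
  by rewrite (le_trans h)// -normrN ler_norm.
rewrite probability_setC// fineB ?fin_num_measure//= measureU//; last first.
- by apply/seteqP; split => // w /= [] ? ?; lra.
- exact: mge.
- exact: mge.
rewrite fineD ?fin_num_measure ?Wz ?Nz//; [lra|exact: mge..].
Qed.

End Gaussian.

Lemma delta_mx_quad {R : realType} K (A : 'M[R]_K) (k : 'I_K) :
  ((delta_mx k 0 : 'cV[R]_K)^T *m A *m (delta_mx k 0 : 'cV[R]_K)) 0 0 = A k k.
Proof. by rewrite trmx_delta -rowE -colE !mxE. Qed.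

(** * Matrix identities for the estimator and its limiting covariance *)

Section PSPSAlgebra.
Context {R : realType} {K : nat}.
Implicit Types (om : 'M[R]_K) (a b c : 'cV[R]_K).

Definition psps_mx om : 'M[R]_(K, K + (K + K)) := row_mx 1%:M (row_mx (- om^T) om^T).

(** The centre [eta] cancels because [b] and [c] carry opposite weights. *)
Lemma theta_PSPS_error om a b c (theta eta : 'cV[R]_K) :
  theta_PSPS om a b c - theta =
  psps_mx om *m col_mx (a - theta) (col_mx (b - eta) (c - eta)).
Proof.
rewrite /psps_mx !mul_row_col mul1mx mulNmx /theta_PSPS !mulmxBr.
rewrite opprB opprD opprK; apply/matrixP => i j; rewrite !mxE; ring.
Qed.

(** Isolates the weight error [om - om'] as a left factor, the form to which [whp_mul_tight]
    applies. *)
Lemma psps_mxB om om' (x : 'cV[R]_(K + (K + K))) :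
  psps_mx om *m x - psps_mx om' *m x =
  (om - om')^T *m (row_mx 0 (row_mx (- 1%:M) 1%:M) *m x).
Proof.
rewrite -mulmxBl mulmxA; congr (_ *m _).
rewrite /psps_mx !mul_mx_row mulmx0 mulmxN mulmx1.
by rewrite opp_row_mx !opp_row_mx !add_row_mx subrr linearB /= opprB opprK addrC.
Qed.

Variables (Vt Vte VL VU : 'M[R]_K) (rho : R).

Definition joint_cov : 'M[R]_(K + (K + K)) :=
  block_mx Vt (row_mx Vte 0) (col_mx Vte 0) (block_mx VL 0 0 (rho *: VU)).

(** Since both off-diagonal blocks are the same [Vte], symmetry of the joint covariance forces [Vte]
    itself to be symmetric. *)
Lemma joint_cov_sym : joint_cov^T = joint_cov ->
  Vte^T = Vte /\ (VL + rho *: VU)^T = VL + rho *: VU.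
Proof.
rewrite /joint_cov tr_block_mx => /eq_block_mx[_ _ h1 h2].
move: h1; rewrite tr_row_mx trmx0 => /eq_col_mx[-> _].
move: h2; rewrite tr_block_mx => /eq_block_mx[hL _ _ hU].
by rewrite linearD /= hL hU.
Qed.

(** Exhibits the quadratic form of [VL + rho *: VU] as a variance of the joint limit, which yields
    its nonnegativity. *)
Lemma joint_cov_quad x :
  (col_mx 0 (col_mx x x))^T *m joint_cov *m (col_mx (0 : 'cV[R]_K) (col_mx x x)) =
  x^T *m (VL + rho *: VU) *m x.
Proof.
rewrite /joint_cov !tr_col_mx trmx0 mul_row_block !mul0mx !add0r.
rewrite mul_row_block !mulmx0 addr0 add0r mul_row_col mulmx0 add0r mul_row_col.
by rewrite mulmxDr mulmxDl.
Qed.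

Lemma V_PSPS_cov : Vte^T = Vte -> VL + rho *: VU \in unitmx ->
  let A := psps_mx (invmx (VL + rho *: VU) *m Vte) in
  A *m joint_cov *m A^T = V_PSPS rho Vt Vte VL VU.
Proof.
move=> VteT Su /=; set S := VL + rho *: VU; set om := invmx S *m Vte.
rewrite /psps_mx /joint_cov mul_row_block !mul1mx !tr_row_mx trmx1.
rewrite mul_row_col mul_row_block !mulmx0 addr0 add0r.
rewrite add_row_mx add0r !mul_row_col mulmx1 !linearN /= !trmxK mulmx0 addr0.
rewrite /V_PSPS VteT -/S -[Vte *m invmx S *m Vte]mulmxA -/om.
rewrite mulmxDl !mulNmx.
(* Since [S *m om = Vte], the quadratic term cancels one of the two cross terms and [Vt - Vte *m om]
   remains. *)
have h : om^T *m VL *m om + om^T *m (rho *: VU) *m om = om^T *m Vte.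
  by rewrite -mulmxDl -mulmxDr -mulmxA /om mulKVmx.
rewrite -h; apply/matrixP => i j; rewrite !mxE; ring.
Qed.

Lemma V_PSPS_diag_le k : (VL + rho *: VU)^T = VL + rho *: VU ->
  VL + rho *: VU \in unitmx ->
  (forall x : 'cV[R]_K, 0 <= (x^T *m (VL + rho *: VU) *m x) 0 0) ->
  V_PSPS rho Vt Vte VL VU k k <= Vt k k.
Proof.
set S := VL + rho *: VU => ST Su S_ge0.
rewrite /V_PSPS [leLHS]mxE [X in _ + X]mxE gerBl -delta_mx_quad.
(* This [x] is the [k]-th column of the optimal weight; the variance reduction at [k] is the form of
   [S] at [x]. *)
pose x : 'cV[R]_K := invmx S *m (Vte *m delta_mx k 0).
suff -> : (delta_mx k 0)^T *m (Vte^T *m invmx S *m Vte) *m delta_mx k 0 =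
  x^T *m S *m x by exact: S_ge0.
by rewrite /x !trmx_mul trmx_inv ST -!mulmxA mulKVmx.
Qed.

End PSPSAlgebra.

(** * Limit theorems for the estimated weight, the estimator and the interval *)

Section PSPSAsymptotics.
Context {R : realType} {d : measure_display} {Omega : measurableType d}.
Variable P : probability Omega R.

Lemma random_theta_PSPS K n m (thL etaL etaU : Omega -> 'cV[R]_K)
    (hVte hVL hVU : Omega -> 'M[R]_K) :
  random_mx P thL -> random_mx P etaL -> random_mx P etaU ->
  random_mx P hVte -> random_mx P hVL -> random_mx P hVU ->
  random_mx P (fun w => theta_PSPS (omega_hat n m (hVte w) (hVL w) (hVU w))
    (thL w) (etaL w) (etaU w)).
Proof.
move=> mt mL mU mte mVL mVU.
have mom : random_mx P (fun w => omega_hat n m (hVte w) (hVL w) (hVU w)).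
  apply: random_mxM => //; apply: random_invmx; apply: random_mxD => //.
  exact: random_mxZ.
apply: random_mxB; first by apply: random_mxM => //; exact: random_mxT.
by apply: random_mxB => //; apply: random_mxM => //; exact: random_mxT.
Qed.

Lemma whp_omega_hat K (N : nat -> nat) (rho : R) (Vte VL VU : 'M[R]_K)
    (hVte hVL hVU : nat -> Omega -> 'M[R]_K) (e : R) :
  (fun n => (n%:R / (N n)%:R : R)) @ \oo --> rho ->
  VL + rho *: VU \in unitmx ->
  (forall n, random_mx P (hVte n)) -> (forall n, random_mx P (hVL n)) ->
  (forall n, random_mx P (hVU n)) ->
  conv_prob P hVte Vte -> conv_prob P hVL VL -> conv_prob P hVU VU -> 0 < e ->
  whp P (fun n => [set w | `|omega_hat n (N n) (hVte n w) (hVL n w) (hVU n w)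
    - invmx (VL + rho *: VU) *m Vte| <= e]).
Proof.
move=> Nrho Su mte mL mU cte cL cU e0.
have [s s0 hs] := omega_hat_limit Vte Su e0.
have := whpI (conv_prob_whp mte cte s0)
  (whpI (conv_prob_whp mL cL s0) (conv_prob_whp mU cU s0)).
apply: whpS; have /cvgrPdist_le/(_ _ s0) := Nrho.
apply: filterS => n; rewrite distrC => nrho w /= [h1 [h2 h3]].
exact: hs.
Qed.

Lemma tight_mull m p q (A : 'M[R]_(m, p)) (X : nat -> Omega -> 'M[R]_(p, q)) :
  tight P X -> tight P (fun n w => A *m X n w).
Proof.
move=> tX a a0; have [M M0 XM] := tX a a0.
(* The summand [1] keeps the bound positive when [A] or [p] is zero. *)
exists (1 + p%:R * (`|A| * M)).
  by rewrite ltr_pwDl// !mulr_ge0// ltW.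
apply: filterS XM => n; apply: fails_leS => w /= XwM.
rewrite (le_trans (mulmx_norm _ _))// (le_trans (_ : _ <= p%:R * (`|A| * M)))//.
  by rewrite !ler_wpM2l.
by rewrite lerDr.
Qed.

(** Continuous mapping: a test function composed with a linear map is again a test function. *)
Lemma weak_cvg_linear {d' : measure_display} {T : measurableType d'}
    (Q : probability T R) m p (A : 'M[R]_(p, m)) (X : nat -> Omega -> 'cV[R]_m)
    (Z : T -> 'cV[R]_m) :
  weak_cvg P Q X Z -> weak_cvg P Q (fun n w => A *m X n w) (fun w => A *m Z w).
Proof.
move=> XZ f cf [M fM]; apply: (XZ (fun x => f (A *m x))); last by exists M.
move=> x; apply: (@continuous_comp _ _ _ (fun x : 'cV[R]_m => A *m x) f); last exact: cf.
have := @cvg_mulmx R _ (nbhs x) _ p m 1 (fun=> A) id A x; apply.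
  exact: cvg_cst.
exact: cvg_id.
Qed.

Lemma tight_rescaled_conv_prob m (X Y : nat -> Omega -> 'cV[R]_m) c :
  (forall n, random_mx P (X n)) ->
  (forall n w, Y n w = Num.sqrt (n%:R : R) *: (X n w - c)) -> tight P Y ->
  conv_prob P X c.
Proof.
move=> mX XY tY; apply: whp_conv_prob => // e e0 a a0.
have [M M0 YM] := tY a a0.
near=> n; apply: (@fails_leS _ _ _ P _ [set w | `|Y n w| <= M]); last by near: n.
move=> w /=; rewrite XY normrZ.
(* Once [n] exceeds [(M / e) ^+ 2], the bound [M] on the rescaled error gives the bound [e] on the
   error itself. *)
have Men : M / e <= Num.sqrt n%:R.
  have Me0 : 0 <= M / e by rewrite divr_ge0// ltW.
  rewrite -(ger0_norm Me0) -sqrtr_sqr ler_sqrt//.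
  near: n; exact: nbhs_infty_ger.
rewrite ger0_norm ?sqrtr_ge0// => h.
have : M / e * `|X n w - c| <= M by rewrite (le_trans _ h)// ler_wpM2r.
by rewrite mulrAC ler_pdivrMr// ler_pM2l.
Unshelve. all: by end_near. Qed.

Lemma gaussian_coverage {d' : measure_display} {T : measurableType d'}
    (Q : probability T R) m (Y : nat -> Omega -> 'cV[R]_m) (Z : T -> 'cV[R]_m)
    (V : 'M[R]_m) (hV : nat -> Omega -> 'M[R]_m) (k : 'I_m) (alpha z : R) :
  (forall n, random_mx P (Y n)) -> random_mx Q Z -> weak_cvg P Q Y Z ->
  gaussian_vector Q Z V -> 0 < V k k ->
  (forall n, random_mx P (hV n)) -> conv_prob P hV V ->
  0 < alpha < 1 -> std_normal_cdf z = (1 - alpha / 2)%:E ->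
  (fun n => P [set w | `|Y n w k 0| < z * Num.sqrt (hV n w k k)]) @ \oo -->
    (1 - alpha)%:E.
Proof.
move=> mY mZ YZ gZ vk mV cV al cdf.
pose s : R := Num.sqrt (V k k).
have s0 : 0 < s by rewrite sqrtr_gt0.
(* The linear form of [Z] along [c / s] times the [k]-th basis vector has variance [1]; the values
   [c = 1] and [c = -1] supply the laws of a standard normal and of its opposite. *)
have law (c : R) : c ^+ 2 = 1 ->
    has_normal0_law Q (fun w => c * (Z w k 0 / s)) 1.
  move=> c1; have := gZ.2 ((c / s) *: delta_mx k 0).
  rewrite linearZ /= -!scalemxAl -scalemxAr scalerA mxE delta_mx_quad.
  rewrite (_ : c / s * (c / s) * V k k = 1); last first.
    rewrite -expr2 exprMn c1 mul1r exprVn sqr_sqrtr ?mulVf ?gt_eqF//.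
    exact: ltW.
  congr (has_normal0_law _ _ _); apply/funext => w.
  by rewrite -scalemxAl mxE trmx_delta -rowE mxE mulrAC mulrA.
pose g (y : 'cV[R]_m) : R := `|y k 0| - z * s.
have cg : continuous g.
  move=> y; apply: (@continuousB _ _ _ (fun y : 'cV[R]_m => `|y k 0|) (cst (z * s))).
    apply: (@continuous_comp _ _ _ (fun y : 'cV[R]_m => y k 0) (fun r : R => `|r|)).
      exact: coord_continuous.
    exact: norm_continuous.
  exact: cst_continuous.
have law1 : has_normal0_law Q (fun w => Z w k 0 / s) 1.
  by have := law 1 (expr1n _ _); under eq_fun do rewrite mul1r.
have lawN : has_normal0_law Q (fun w => - (Z w k 0 / s)) 1.
  by have := law (-1) (sqrr_sign _ 1); under eq_fun do rewrite mulN1r.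
have [Q0 Qlt] := normal_two_sided law1 lawN al cdf.
have gs w : g (Z w) = s * (`|Z w k 0 / s| - z).
  by rewrite /g normrM normfV (gtr0_norm s0) mulrBr mulrCA divff ?mulr1 1?mulrC// gt_eqF.
have gQ0 : Q [set w | g (Z w) = 0] = 0%E.
  rewrite -Q0; congr (Q _); apply/seteqP; split => w /=; rewrite gs.
    by move/eqP; rewrite mulf_eq0 gt_eqF//= subr_eq0 => /eqP.
  by move=> ->; rewrite subrr mulr0.
have gQlt : Q [set w | g (Z w) < 0] = (1 - alpha)%:E.
  rewrite -Qlt; congr (Q _); apply/seteqP; split => w /=;
  by rewrite gs pmulr_rlt0// subr_lt0.
pose U n w : R := `|Y n w k 0| - z * Num.sqrt (hV n w k k).
have msqrt : measurable_fun setT (@Num.sqrt R).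
  by apply: continuous_measurable_fun; exact: sqrt_continuous.
have mU' n : measurable_fun setT (U n).
  apply: measurable_funB; first exact: measurableT_comp (mY n k 0).
  apply: measurable_funM; first exact: measurable_cst.
  exact: measurableT_comp (mV n k k).
have Ug (e : R) : 0 < e -> whp P (fun n => [set w | `|U n w - g (Y n w)| <= e]).
  (* The difference is [z] times the error of the estimated standard deviation; dividing by
     [|z| + 1] covers [z = 0] too. *)
  move=> e0; have ez0 : 0 < e / (`|z| + 1) by rewrite divr_gt0// ltr_wpDl.
  have /cvgrPdist_le/(_ _ ez0)/nbhs_ballP[r /= r0 hr] := @sqrt_continuous R (V k k).
  have r20 : 0 < r / 2 by rewrite divr_gt0.
  apply: whpS (conv_prob_whp mV cV r20); near=> n => w /= h.
  rewrite (_ : U n w - g (Y n w) = z * (s - Num.sqrt (hV n w k k))); last first.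
    by rewrite /U /g; ring.
  have /hr hs : ball (V k k) r (hV n w k k).
    rewrite -ball_normE/= distrC (le_lt_trans (_ : _ <= r / 2))//; last by lra.
    by rewrite (le_trans _ h)//; have := le_mx_norm (hV n w - V) k k; rewrite !mxE.
  rewrite normrM (le_trans (ler_wpM2l (normr_ge0 z) hs))// mulrCA ler_piMr// 1?ltW//.
  by rewrite ltr_pdivrMr ?mul1r ?ltrDl// ltr_wpDl.
have := portmanteau_lt0 mY mZ YZ cg gQ0 mU' Ug; rewrite gQlt.
by under eq_fun do under eq_set do rewrite subr_lt0.
Unshelve. all: by end_near. Qed.

End PSPSAsymptotics.

Theorem theorem1 (R : realType) (K : nat) (d : measure_display)
  (Omega : measurableType d) (P : probability Omega R)
  (theta_star eta : 'cV[R]_K) (N : nat -> nat) (rho : R)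
  (thL etaL etaU : nat -> Omega -> 'cV[R]_K)
  (Vt Vte VL VU : 'M[R]_K)
  (hVte hVL hVU : nat -> Omega -> 'M[R]_K) :
  (0 < K)%N ->
  0 < rho ->
  (fun n => (N n)%:R : R) @ \oo --> +oo ->
  (fun n => (n%:R / (N n)%:R : R)) @ \oo --> rho ->
  (forall n, random_mx P (thL n)) ->
  (forall n, random_mx P (etaL n)) ->
  (forall n, random_mx P (etaU n)) ->
  conv_dist_gauss P
    (fun n w => Num.sqrt (n%:R : R) *:
       col_mx (thL n w - theta_star) (col_mx (etaL n w - eta) (etaU n w - eta)))
    (block_mx Vt (row_mx Vte 0) (col_mx Vte 0)
              (block_mx VL 0 0 (rho *: VU))) ->
  (VL + rho *: VU) \in unitmx ->
  (forall n, random_mx P (hVte n)) ->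
  (forall n, random_mx P (hVL n)) ->
  (forall n, random_mx P (hVU n)) ->
  conv_prob P hVte Vte -> conv_prob P hVL VL -> conv_prob P hVU VU ->
  let thPSPS := fun n w =>
    theta_PSPS (omega_hat n (N n) (hVte n w) (hVL n w) (hVU n w))
               (thL n w) (etaL n w) (etaU n w) in
  let VP := V_PSPS rho Vt Vte VL VU in
  (* (i) *)
  (conv_prob P thPSPS theta_star /\
   conv_dist_gauss P (fun n w => Num.sqrt (n%:R : R) *: (thPSPS n w - theta_star)) VP)
  /\
  (* (ii) *)
  (forall k : 'I_K, col k Vte != 0 -> (posdef VL \/ posdef VU) -> VP k k <= Vt k k)
  /\
  (* (iii) *)
  (forall (hVP : nat -> Omega -> 'M[R]_K), (forall n, random_mx P (hVP n)) ->
   conv_prob P hVP VP ->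
   forall (alpha z : R), 0 < alpha < 1 ->
   std_normal_cdf z = (1 - alpha / 2)%:E ->
   forall k : 'I_K, 0 < VP k k ->
   (fun n => P [set w | theta_star k 0 \in
        `]thPSPS n w k 0 - z * Num.sqrt (hVP n w k k / n%:R),
          thPSPS n w k 0 + z * Num.sqrt (hVP n w k k / n%:R)[])
   @ \oo --> (1 - alpha)%:E).
Proof.
move=> K0 rho0 _ Nrho mt mL mU [d' [T [Q [Z [mZ [gZ cvZ]]]]]] Su mte mVL mVU cte cL cU.
move=> thPSPS VP.
pose om n w : 'M[R]_K := omega_hat n (N n) (hVte n w) (hVL n w) (hVU n w).
pose X n w : 'cV[R]_(K + (K + K)) := Num.sqrt (n%:R : R) *: col_mx (thL n w - theta_star)
  (col_mx (etaL n w - eta) (etaU n w - eta)).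
have mX n : random_mx P (X n).
  apply: random_mxZ; apply: random_col_mx.
    by apply: random_mxB => //; exact: random_mx_cst.
  by apply: random_col_mx; apply: random_mxB => //; exact: random_mx_cst.
have XZ : weak_cvg P Q X Z by exact/weak_cvgP.
have tX := weak_cvg_tight mX mZ XZ.
have [VteT ST] := joint_cov_sym gZ.1.
pose A0 := psps_mx (invmx (VL + rho *: VU) *m Vte).
pose Y n w : 'cV[R]_K := Num.sqrt (n%:R : R) *: (thPSPS n w - theta_star).
have YE n w : Y n w = psps_mx (om n w) *m X n w.
  by rewrite /Y /thPSPS (theta_PSPS_error _ _ _ _ _ eta) scalemxAr.
have mth n : random_mx P (thPSPS n) by exact: random_theta_PSPS.
have mY n : random_mx P (Y n).
  by apply: random_mxZ; apply: random_mxB => //; exact: random_mx_cst.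
have mA0X n : random_mx P (fun w => A0 *m X n w).
  by apply: random_mxM => //; exact: random_mx_cst.
have mA0Z : random_mx Q (fun w => A0 *m Z w).
  by apply: random_mxM => //; exact: random_mx_cst.
(* Replacing the estimated weight by its limit costs a vanishing factor times a tight vector. *)
have XY e : 0 < e -> whp P (fun n => [set w | `|A0 *m X n w - Y n w| <= e]).
  move=> e0.
  have D0 e' : 0 < e' ->
      whp P (fun n => [set w | `|(invmx (VL + rho *: VU) *m Vte - om n w)^T| <= e']).
    move=> e'0; have := whp_omega_hat Nrho Su mte mVL mVU cte cL cU e'0.
    by apply: whpS; near=> n => w /=; rewrite mx_norm_trmx distrC.
  have := whp_mul_tight D0 (tight_mull (row_mx 0 (row_mx (- 1%:M) 1%:M)) tX) e0.
  by apply: whpS; near=> n => w /=; rewrite YE -psps_mxB.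
have YZ : weak_cvg P Q Y (fun w => A0 *m Z w).
  have A0XZ := @weak_cvg_linear _ _ _ _ _ _ Q _ _ A0 X Z XZ.
  exact: (@slutsky _ _ _ _ _ _ Q _ _ _ mA0X mA0Z A0XZ Y mY XY).
have gY : gaussian_vector Q (fun w => A0 *m Z w) VP.
  by have := gaussian_vector_linear A0 gZ; rewrite V_PSPS_cov.
split; [split|split].
- apply: (tight_rescaled_conv_prob (Y := Y) mth _ (weak_cvg_tight mY mA0Z YZ)).
  by [].
- exists d', T, Q, (fun w => A0 *m Z w); split => //; split => //.
  exact/weak_cvgP.
(* Nonnegativity of the form is the nonnegative variance contained in the Gaussian law of the
   limit. *)
- move=> k _ _; apply: V_PSPS_diag_le => // x.
  by have [_ + _] := gZ.2 (col_mx 0 (col_mx x x)); rewrite joint_cov_quad.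
- move=> hVP mVP cVP alpha z al cdf k vk.
  have := gaussian_coverage mY mA0Z YZ gY vk mVP cVP al cdf.
  apply: cvg_trans; apply: near_eq_cvg; near=> n.
  (* For [n > 0], multiplying the interval condition by the root of [n] turns it into a condition on
     [Y]; the index [0], with its division by zero, is discarded. *)
  have n0 : 0 < Num.sqrt (n%:R : R).
    by rewrite sqrtr_gt0 ltr0n; near: n; exact: nbhs_infty_gt.
  congr (P _); apply/funext => w /=; congr is_true; apply/esym.
  (* The inverse of [n] is moved in front because splitting the root asks only the first factor to
     be nonnegative, and [hVP n w k k] may be negative. *)
  rewrite in_itv/= -ltr_distlC [hVP n w k k / _]mulrC sqrtrM ?invr_ge0// sqrtrV//.
  by rewrite mulrCA [ltRHS]mulrC ltr_pdivlMr// !mxE normrM (gtr0_norm n0) [X in X < _]mulrC.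
Unshelve. all: by end_near. Qed.
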